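(* Let $0<\alpha,\beta,\xi\le1$ and let $\phi_{out}\le a\frac{\xi\alpha\beta\phi_{in}^2}{k^3\log n}$ for a sufficiently small absolute constant $a>0$. Let $G$ be a weighted $d$-regular $n$-vertex graph that is $(k,\phi_{in},\phi_{out})$-clusterable with underlying clusters $C_1,\dots,C_h$, $h\le k$. Then for each $C_i$ with $|C_i|\ge\alpha n$ there exists $C_i'\subseteq C_i$ with $|C_i'|\ge(1-\beta)|C_i|$ such that for every $v\in C_i'$ and $t=\frac{20\log n}{\phi_{in}^2}$, $$\|\mathbf p_v^t-\mathbf u_{C_i}\|_{TV}\le\xi.$$
   Context: A weighted $d$-regular graph has a symmetric nonnegative adjacency matrix $A$ (self-loops allowed) whose row sums all equal $d$. For $S\subseteq V$, $\phi_G(S)=\frac{w(S,V\setminus S)}{d|S|}$ where $w(S,T)=\sum_{u\in S,v\in T}A(u,v)$; the inner conductance of $S$ is $\min_{T\subseteq S,|T|\le|S|/2}\frac{w(T,S\setminus T)}{d|T|}$ (equal to $1$ if $|S|=1$). $G$ is $(k,\phi_{in},\phi_{out})$-clusterable with clusters $C_1,\dots,C_h$ ($h\le k$) if these partition $V$ and each has inner conductance $\ge\phi_{in}$ and $\phi_G(C_i)\le\phi_{out}$. The random walk has transition matrix $P=\frac12(I+\frac1dA)$; $\mathbf p_v^t=\mathbf 1_vP^t$ is the distribution after $t$ steps from $v$. $\mathbf u_C$ is the uniform distribution on $C$; $\|\cdot\|_{TV}$ is total variation distance.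
   Formalization: The formal version adds the hypothesis ξ ≥ n^{-4} (for fixed n the claim fails for very small ξ, since t does not depend on ξ), and takes t to be any integer within distance less than 1 of 20 log n/φ_in², with log natural. *)

(* Defs.v *)
From HB Require Import structures.
From mathcomp Require Import all_boot all_order all_algebra.
From mathcomp Require Import reals exp.

Set Implicit Arguments.
Unset Strict Implicit.
Unset Printing Implicit Defensive.

Import Order.TTheory GRing.Theory Num.Theory.
Local Open Scope ring_scope.

Section Graphs.
Variables (R : realType) (n : nat).
Implicit Types (A : 'M[R]_n) (d : R) (S T C : {set 'I_n}).

Definition weighted_regular A d : Prop :=
  [/\ forall u v, A u v = A v u,
      forall u v, 0 <= A u v
    & forall u, \sum_v A u v = d].

Definition weight A S T : R := \sum_(u in S) \sum_(v in T) A u v.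

Definition conductance A d S : R := weight A S (~: S) / (d * #|S|%:R).

Definition inner_cut S T : bool :=
  [&& T != set0, T \subset S & (#|T|.*2 <= #|S|)%N].

(* The minimum is capped at 1.  In a d-regular graph every term is at most 1
   (lemma inner_term_le1), so the cap only supplies the value when there is no
   admissible T, that is, the convention 1 for singletons. *)
Definition inner_conductance A d S : R :=
  \big[Num.min/1]_(T : {set 'I_n} | inner_cut S T)
    (weight A T (S :\: T) / (d * #|T|%:R)).

(* The clusters C_1, ..., C_h are the h = #|Cs| blocks of Cs; [partition]
   forces them to be nonempty. *)
Definition clusterable A d (k : nat) (phi_in phi_out : R)
    (Cs : {set {set 'I_n}}) : Prop :=
  [/\ partition Cs [set: 'I_n],
      (#|Cs| <= k)%N
    & forall C, C \in Cs ->
        phi_in <= inner_conductance A d C /\ conductance A d C <= phi_out].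

Definition transition A d : 'M[R]_n := 2^-1 *: (1%:M + d^-1 *: A).

Definition walk_dist A d (v : 'I_n) (t : nat) : 'rV[R]_n :=
  delta_mx 0 v *m transition A d ^+ t.

Definition uniform_on C : 'rV[R]_n :=
  \row_i (if i \in C then #|C|%:R^-1 else 0).

Definition tv_dist (p q : 'rV[R]_n) : R :=
  2^-1 * \sum_i `|p 0 i - q 0 i|.

Lemma inner_term_le1 A d S T : 0 < d -> weighted_regular A d ->
  inner_cut S T -> weight A T (S :\: T) / (d * #|T|%:R) <= 1.
Proof.
move=> d0 [_ A0 Ad] /and3P[T0 _ _].
have cT : 0 < d * #|T|%:R :> R by rewrite mulr_gt0 // ltr0n card_gt0.
rewrite ler_pdivrMr // mul1r mulr_natr -sumr_const.
apply: ler_sum => u _; rewrite -(Ad u) [leRHS](bigID (mem (S :\: T))) /=.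
by rewrite lerDl sumr_ge0.
Qed.

Lemma inner_conductance1 A d S : #|S| = 1%N -> inner_conductance A d S = 1.
Proof.
move=> S1; rewrite /inner_conductance big_pred0 // => T; apply/negbTE.
apply/and3P => -[]; rewrite -card_gt0 S1.
by case: #|T|.
Qed.

Lemma inner_conductance_min A d S : 0 < d -> weighted_regular A d ->
  (1 < #|S|)%N ->
  (exists2 T, inner_cut S T &
     inner_conductance A d S = weight A T (S :\: T) / (d * #|T|%:R)) /\
  (forall T, inner_cut S T ->
     inner_conductance A d S <= weight A T (S :\: T) / (d * #|T|%:R)).
Proof.
move=> d0 Areg S1; split; last by move=> T cT; exact: bigmin_le_cond.
have [x xS] : exists x, x \in S by apply/card_gt0P; exact: ltnW.
have cx : inner_cut S [set x].
  by rewrite /inner_cut -card_gt0 cards1 sub1set xS S1.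
have le1 T : inner_cut S T -> weight A T (S :\: T) / (d * #|T|%:R) <= 1.
  exact: inner_term_le1.
by have [T cT eT] := eq_bigmin [set x] _ _ cx le1; exists T.
Qed.

End Graphs.

(* Main.v *)
Require Import Defs.
From mathcomp Require Import all_boot all_order all_algebra.
From mathcomp Require Import reals sequences exp.
From mathcomp Require Import zify ring lra.

(* Fix a cluster C and compare the walk with the walk reflected in C, where
   edges leaving C are turned into self-loops.  Cheeger's inequality gives the
   reflected walk spectral gap phi_in^2/4, and being lazy it is positive
   semidefinite, so after t steps it is within n^-4/2 <= xi/2 of uniform.
   Both walks dominate the walk killed on leaving C, so they differ in total
   variation by at most the escape probability.  From a uniform start in C the
   killed walk has mass at most 1/|C| at every vertex and loses at most
   phi_out/2 per step; Markov's inequality then bounds by beta |C| the number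
   of starting points whose escape probability exceeds xi/2. *)

Set Implicit Arguments.
Unset Strict Implicit.
Unset Printing Implicit Defensive.

Import Order.TTheory GRing.Theory Num.Theory.
Local Open Scope ring_scope.

(** * Cauchy-Schwarz from discriminants, and medians of functions on finite sets *)

Section OrderedFieldFacts.
Variable R : realFieldType.

(** Evaluating at the minimiser [- y / z] gives the bound. It is the common source of Cauchy-Schwarz
    for weighted sums and for semidefinite matrix forms. *)
Lemma discriminant_le0 (x y z : R) :
  0 <= z -> (forall s, 0 <= x + 2 * s * y + s ^+ 2 * z) -> y ^+ 2 <= x * z.
Proof.
rewrite le_eqVlt => /predU1P[<-|z0] H.
  have [->|y0] := eqVneq y 0; first by rewrite mulr0 expr0n.
  (* With [z = 0] the function is affine in [s]; a nonzero slope lets it take the value -1 here. *)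
  have := H (- (x + 1) / (2 * y)).
  have -> : x + 2 * (- (x + 1) / (2 * y)) * y + (- (x + 1) / (2 * y)) ^+ 2 * 0
    = -1 by field.
  by lra.
have := H (- y / z).
have -> : x + 2 * (- y / z) * y + (- y / z) ^+ 2 * z = (x * z - y ^+ 2) / z.
  by field; rewrite gt_eqF.
by rewrite pmulr_lge0 ?invr_gt0 // subr_ge0.
Qed.

Lemma cauchy_schwarz_sum (I : finType) (P : pred I) (w a b : I -> R) :
  (forall i, P i -> 0 <= w i) ->
  (\sum_(i | P i) w i * (a i * b i)) ^+ 2 <=
  (\sum_(i | P i) w i * a i ^+ 2) * (\sum_(i | P i) w i * b i ^+ 2).
Proof.
move=> w0; apply: discriminant_le0 => [|s].
  by apply: sumr_ge0 => i Pi; rewrite mulr_ge0 ?w0 ?sqr_ge0.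
have -> : \sum_(i | P i) w i * a i ^+ 2 + 2 * s * \sum_(i | P i) w i * (a i * b i)
    + s ^+ 2 * \sum_(i | P i) w i * b i ^+ 2
  = \sum_(i | P i) w i * (a i + s * b i) ^+ 2.
  by rewrite !mulr_sumr -!big_split /=; apply: eq_bigr => i _; ring.
by apply: sumr_ge0 => i Pi; rewrite mulr_ge0 ?w0 ?sqr_ge0.
Qed.

(** The median is the least value of [f] on [C] with at most half of [C] strictly above it. If more
    than half lay strictly below, the largest value below would also have at most half above it,
    against minimality. *)
Lemma exists_median (T : finType) (C : {set T}) (f : T -> R) : C != set0 ->
  exists m : R, (#|[set x in C | (m < f x)%R]|.*2 <= #|C|)%N /\
            (#|[set x in C | (f x < m)%R]|.*2 <= #|C|)%N.
Proof.
case/set0Pn => x0 x0C.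
pose up y := [set x in C | f y < f x].
have [y yC ymax] : exists2 y, y \in C & forall x, x \in C -> f x <= f y.
  by case: (arg_maxP f x0C) => y yC ymax; exists y.
have upy : (y \in C) && (#|up y|.*2 <= #|C|)%N.
  rewrite yC (_ : up y = set0) ?cards0 //; apply/setP => x; rewrite !inE.
  by apply/negP => /andP[xC]; rewrite ltNge ymax.
pose Q z := (z \in C) && (#|up z|.*2 <= #|C|)%N.
case: (@arg_minP _ _ _ y Q f upy) => z /andP[zC upz] zmin.
exists (f z); split => //; rewrite leqNgt; apply/negP => big.
set D := [set x in C | f x < f z] in big.
have [w0 w0D] : exists w, w \in D.
  by apply/card_gt0P; case: #|D| big => //; rewrite ltn0.
case: (arg_maxP f w0D) => w wD wmax.
have /andP[wC wz] : (w \in C) && (f w < f z) by move: (wD : w \in D); rewrite inE.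
suff /zmin : Q w by rewrite leNgt wz.
rewrite /Q wC /=.
have upw : up w \subset C :\: D.
  apply/subsetP => x; rewrite !inE => /andP[xC wx]; rewrite xC andbT /=.
  apply/negP => xz; have : x \in D by rewrite inE xC.
  by move=> /wmax; rewrite /= leNgt wx.
have DC : D \subset C by apply/subsetP => x; rewrite inE => /andP[].
have := subset_leq_card upw; rewrite cardsD (setIidPr DC) => h.
have hD := subset_leq_card DC.
rewrite -!addnn in big *; lia.
Qed.

End OrderedFieldFacts.

(** * Cheeger's inequality inside a cluster *)

Section Cheeger.
Variables (R : realType) (n : nat).
Implicit Types (A : 'M[R]_n) (d phi : R) (S C : {set 'I_n}) (f h : 'I_n -> R).

Lemma weight_inner_ge A d phi C S : 0 < d -> phi <= inner_conductance A d C ->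
  inner_cut C S -> phi * d * #|S|%:R <= weight A S (C :\: S).
Proof.
move=> d0 hphi cS.
have S0 : 0 < d * #|S|%:R :> R.
  by case/and3P: cS => S0 _ _; rewrite mulr_gt0 // ltr0n card_gt0.
rewrite -mulrA -ler_pdivlMr // (le_trans hphi) //.
exact: bigmin_le_cond.
Qed.

(** Indicators spread the cut over all pairs in [C], so that it can be added term by term to the sum
    in the coarea inequality. *)
Lemma weight_setDE A C S : S \subset C ->
  weight A S (C :\: S) =
  \sum_(u in C) \sum_(v in C) A u v * ((u \in S)%:R * (v \notin S)%:R).
Proof.
move=> SC; rewrite /weight [RHS](big_setID S) /= (setIidPr SC).
rewrite [X in _ = _ + X]big1 ?addr0 => [|u]; last first.
  rewrite inE => /andP[/negbTE uS _]; apply: big1 => v _.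
  by rewrite uS mul0r mulr0.
apply: eq_bigr => u uS; rewrite [RHS](big_setID S) /=.
rewrite [X in _ = X + _]big1 ?add0r => [|v]; last first.
  by rewrite inE => /andP[_ vS]; rewrite vS mulr0 mulr0.
by apply: eq_bigr => v; rewrite inE => /andP[vS _]; rewrite uS vS !mulr1.
Qed.

(* Peeling off the lowest positive level of [f] replaces the coarea integral. *)
Lemma coarea_ineq A d phi C f : 0 < d -> weighted_regular A d ->
  phi <= inner_conductance A d C ->
  (forall u, 0 <= f u) ->
  (forall u, u \notin C -> f u = 0) ->
  (#|[set u | f u != 0%R]|.*2 <= #|C|)%N ->
  2 * (phi * d * \sum_(u in C) f u) <=
  \sum_(u in C) \sum_(v in C) A u v * `|f u - f v|.
Proof.
move=> d0 [Asym A0 _] hphi.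
have [k] := ubnP #|[set u | f u != 0]|; elim: k f => // k IH f.
set S := [set u | f u != 0] => Sk f0 fC S2.
have [S0|Sn0] := eqVneq S set0.
  have fz u : f u = 0.
    by apply/eqP/negPn; have := in_set0 u; rewrite -S0 inE => ->.
  rewrite [\sum_(u in C) f u]big1 => [|u _]; last exact: fz.
  rewrite !mulr0; apply: sumr_ge0 => u _; apply: sumr_ge0 => v _.
  exact: mulr_ge0.
have SC : S \subset C.
  by apply/subsetP => u; rewrite inE; apply: contra_neqT => /fC.
have [x0 x0S] := set0Pn _ Sn0.
case: (arg_minP f x0S) => x xS' xmin; have xS : x \in S := xS'.
set m := f x in xmin.
have m0 : 0 < m by rewrite lt_def f0 andbT; move: xS; rewrite inE.
(* Lowering [f] by its least positive value [m] on its support makes the minimiser [x] drop out, so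
   the induction on the size of the support applies to [g]. *)
pose g u := f u - m * (u \in S)%:R.
have g0 u : 0 <= g u.
  by rewrite /g; case: (boolP (u \in S)) => uS; rewrite ?mulr1 ?mulr0 subr_ge0 ?xmin.
have fE u : u \notin S -> f u = 0 by rewrite inE negbK => /eqP.
have gC u : u \notin C -> g u = 0.
  move=> uC; have uS : u \notin S by apply: contra uC; exact: (subsetP SC).
  by rewrite /g (negbTE uS) mulr0 subr0 fE.
have gS : [set u | g u != 0] \proper S.
  apply/properP; split.
    apply/subsetP => u; rewrite inE; apply: contra_neqT => uS.
    by rewrite /g (negbTE uS) mulr0 subr0 fE.
  by exists x => //; rewrite inE negbK /g xS mulr1 subrr.
have g2 : (#|[set u | g u != 0%R]|.*2 <= #|C|)%N.
  by rewrite (leq_trans _ S2) // leq_double ltnW // proper_card.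
have gIH := IH g (leq_trans (proper_card gS) Sk) g0 gC g2.
have cS : inner_cut C S by rewrite /inner_cut Sn0 SC.
have wS := weight_inner_ge d0 hphi cS.
have sumf : \sum_(u in C) f u = \sum_(u in C) g u + m * #|S|%:R.
  have -> : m * #|S|%:R = \sum_(u in C) m * (u \in S)%:R.
    rewrite -mulr_sumr (big_setID S) /= (setIidPr SC) [X in _ + X]big1 ?addr0.
      by rewrite (eq_bigr (fun=> 1)) ?sumr_const // => u ->.
    by move=> u; rewrite inE => /andP[/negbTE -> _].
  by rewrite -big_split /=; apply: eq_bigr => u _; rewrite /g subrK.
have sumA : \sum_(u in C) \sum_(v in C) A u v * `|f u - f v| =
    \sum_(u in C) \sum_(v in C) A u v * `|g u - g v| +
    m * (2 * weight A S (C :\: S)).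
  (* The sum runs over ordered pairs, so by symmetry each edge of the cut is met twice. *)
  have wE : 2 * weight A S (C :\: S) = \sum_(u in C) \sum_(v in C)
      A u v * ((u \in S)%:R * (v \notin S)%:R + (v \in S)%:R * (u \notin S)%:R).
    have wE' : weight A S (C :\: S) = \sum_(u in C) \sum_(v in C)
        A u v * ((v \in S)%:R * (u \notin S)%:R).
      rewrite weight_setDE // exchange_big /=.
      by apply: eq_bigr => u _; apply: eq_bigr => v _; rewrite Asym.
    rewrite mulrDl mul1r {1}weight_setDE // wE' -big_split /=.
    apply: eq_bigr => u _; rewrite -big_split /=; apply: eq_bigr => v _.
    by rewrite mulrDr.
  rewrite wE mulr_sumr -big_split /=; apply: eq_bigr => u _.
  rewrite mulr_sumr -big_split /=; apply: eq_bigr => v _.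
  rewrite mulrCA -mulrDr; congr (_ * _).
  (* Peeling never reverses the order of two values: a difference is unchanged unless exactly one
     end lies in [S], and then it falls by exactly [m]. *)
  rewrite /g; case: (boolP (u \in S)) => uS; case: (boolP (v \in S)) => vS /=;
    rewrite ?(fE _ uS) ?(fE _ vS) ?mulr1 ?mulr0 ?subr0 ?sub0r ?normrN ?addr0
      ?add0r ?mulr0 ?mulr1 ?addr0 ?normr0 //.
  - by congr `|_|; ring.
  - have fm := xmin _ uS; rewrite !ger0_norm ?subr_ge0 //; ring.
  - have fm := xmin _ vS; rewrite !ger0_norm ?subr_ge0 //; ring.
have := ler_wpM2l (ltW m0) wS; rewrite sumf sumA.
by move: gIH; lra.
Qed.

(* Cauchy-Schwarz applied to [|h u ^+ 2 - h v ^+ 2| = |h u - h v| * |h u + h v|]. *)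
Lemma cheeger_half_support A d phi C h : 0 < d -> weighted_regular A d ->
  0 <= phi -> phi <= inner_conductance A d C ->
  (forall u, u \notin C -> h u = 0) -> (forall u, 0 <= h u) ->
  (#|[set u | h u != 0%R]|.*2 <= #|C|)%N ->
  phi ^+ 2 * d * \sum_(u in C) h u ^+ 2 <=
  \sum_(u in C) \sum_(v in C) A u v * (h u - h v) ^+ 2.
Proof.
move=> d0 Areg phi0 hphi hC h0 h2.
have [Asym A0 Ad] := Areg.
have hsq u : (h u ^+ 2 != 0) = (h u != 0) by rewrite sqrf_eq0.
have := @coarea_ineq A d phi C (fun u => h u ^+ 2) d0 Areg hphi
  (fun u => sqr_ge0 _) (fun u uC => etrans (congr1 (fun x => x ^+ 2) (hC u uC))
  (expr0n _ 2)).
have -> : [set u | h u ^+ 2 != 0] = [set u | h u != 0].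
  by apply/setP => u; rewrite !inE hsq.
move=> /(_ h2).
set X := \sum_(u in C) h u ^+ 2; set Y := \sum_(u in C) _ => coarea.
set E := leRHS.
have X0 : 0 <= X by apply: sumr_ge0 => u _; exact: sqr_ge0.
pose F := \sum_(u in C) \sum_(v in C) A u v * (h u + h v) ^+ 2.
have E0 : 0 <= E.
  by do 2!(apply: sumr_ge0 => ? _); rewrite mulr_ge0 ?sqr_ge0.
have YEF : Y ^+ 2 <= E * F.
  pose CC := [pred p : 'I_n * 'I_n | (p.1 \in C) && (p.2 \in C)].
  have -> : Y = \sum_(p | CC p)
      A p.1 p.2 * (`|h p.1 - h p.2| * `|h p.1 + h p.2|).
    rewrite /Y pair_big /=; apply: eq_bigr => p _.
    by rewrite -normrM; congr (_ * `|_|); ring.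
  have -> : E = \sum_(p | CC p) A p.1 p.2 * `|h p.1 - h p.2| ^+ 2.
    by rewrite /E pair_big /=; apply: eq_bigr => p _; rewrite real_normK ?num_real.
  have -> : F = \sum_(p | CC p) A p.1 p.2 * `|h p.1 + h p.2| ^+ 2.
    by rewrite /F pair_big /=; apply: eq_bigr => p _; rewrite real_normK ?num_real.
  exact: cauchy_schwarz_sum.
have FX : F <= 4 * d * X.
  have row u : \sum_(v in C) A u v <= d.
    rewrite -(Ad u) [leRHS](bigID (mem C)) /= lerDl.
    by apply: sumr_ge0.
  have half : \sum_(u in C) \sum_(v in C) A u v * h u ^+ 2 <= d * X.
    rewrite mulr_sumr; apply: ler_sum => u _; rewrite -mulr_suml.
    by rewrite ler_wpM2r ?sqr_ge0.
  have half' : \sum_(u in C) \sum_(v in C) A u v * h v ^+ 2 <= d * X.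
    rewrite exchange_big /=; apply: le_trans half; apply: ler_sum => u _.
    by apply: ler_sum => v _; rewrite Asym.
  have : F <= 2 * (\sum_(u in C) \sum_(v in C) A u v * h u ^+ 2 +
      \sum_(u in C) \sum_(v in C) A u v * h v ^+ 2).
    rewrite -big_split mulr_sumr /=; apply: ler_sum => u _.
    rewrite -big_split mulr_sumr /=; apply: ler_sum => v _.
    (* The slack in [(a + b)^2 <= 2 (a^2 + b^2)] is [(a - b)^2]. *)
    have := mulr_ge0 (A0 u v) (sqr_ge0 (h u - h v)); nra.
  by move: half half'; lra.
have [X00|Xn0] := eqVneq X 0; first by rewrite X00 mulr0.
have Xp : 0 < X by rewrite lt_def Xn0.
have pdX : 0 <= phi * d * X by rewrite !mulr_ge0 // ltW.
have Y2 : (2 * (phi * d * X)) ^+ 2 <= E * (4 * d * X).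
  apply: (@le_trans _ _ (Y ^+ 2)).
    have L0 : 0 <= 2 * (phi * d * X) by rewrite mulr_ge0.
    by apply: lerXn2r; rewrite ?nnegrE // (le_trans L0 coarea).
  by apply: le_trans YEF _; rewrite ler_wpM2l.
have dX : 0 < 4 * d * X by rewrite !mulr_gt0.
rewrite -(ler_pM2r dX); apply: le_trans Y2; rewrite le_eqVlt; apply/orP; left.
by apply/eqP; ring.
Qed.

(** Subtracting a median [m] from [f] leaves a positive part [hp] and a negative part [hn], each
    supported on at most half of [C]. Applying the half-support case to both loses no constant. *)
Lemma cheeger_ineq A d phi C f : 0 < d -> weighted_regular A d ->
  0 <= phi -> phi <= inner_conductance A d C ->
  \sum_(u in C) f u = 0 ->
  phi ^+ 2 * d * \sum_(u in C) f u ^+ 2 <=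
  \sum_(u in C) \sum_(v in C) A u v * (f u - f v) ^+ 2.
Proof.
move=> d0 Areg phi0 hphi sf.
have [_ A0 _] := Areg.
have [->|Cn0] := eqVneq C set0; first by rewrite !big_set0 mulr0.
have [m [mup mlo]] := exists_median f Cn0.
pose hp u := if u \in C then Num.max (f u - m) 0 else 0.
pose hn u := if u \in C then Num.max (m - f u) 0 else 0.
have cp : phi ^+ 2 * d * \sum_(u in C) hp u ^+ 2 <=
    \sum_(u in C) \sum_(v in C) A u v * (hp u - hp v) ^+ 2.
  apply: cheeger_half_support => //.
  - by move=> u /negbTE uC; rewrite /hp uC.
  - by move=> u; rewrite /hp; case: ifP => // _; rewrite le_max lexx orbT.
  - rewrite (leq_trans _ mup) // leq_double subset_leq_card //.
    apply/subsetP => u; rewrite !inE /hp; case: ifP => uC; rewrite ?eqxx //=.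
    by apply: contraNT; rewrite -leNgt => fm; apply/eqP/max_idPr; rewrite subr_le0.
have cn : phi ^+ 2 * d * \sum_(u in C) hn u ^+ 2 <=
    \sum_(u in C) \sum_(v in C) A u v * (hn u - hn v) ^+ 2.
  apply: cheeger_half_support => //.
  - by move=> u /negbTE uC; rewrite /hn uC.
  - by move=> u; rewrite /hn; case: ifP => // _; rewrite le_max lexx orbT.
  - rewrite (leq_trans _ mlo) // leq_double subset_leq_card //.
    apply/subsetP => u; rewrite !inE /hn; case: ifP => uC; rewrite ?eqxx //=.
    by apply: contraNT; rewrite -leNgt => fm; apply/eqP/max_idPr; rewrite subr_le0.
have pd0 : 0 <= phi ^+ 2 * d by rewrite mulr_ge0 ?sqr_ge0 // ltW.
have sumsq : \sum_(u in C) f u ^+ 2 <=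
    \sum_(u in C) hp u ^+ 2 + \sum_(u in C) hn u ^+ 2.
  (* As [f] sums to zero on [C], the cross term vanishes and shifting by [m] can only increase the
     sum of squares. *)
  apply: (@le_trans _ _ (\sum_(u in C) (f u - m) ^+ 2)).
    have -> : \sum_(u in C) (f u - m) ^+ 2 =
        \sum_(u in C) f u ^+ 2 - 2 * m * \sum_(u in C) f u
        + \sum_(u in C) m ^+ 2.
      rewrite mulr_sumr -sumrB -big_split /=; apply: eq_bigr => u _; ring.
    by rewrite sf mulr0 subr0 lerDl; apply: sumr_ge0 => u _; exact: sqr_ge0.
  rewrite -big_split /=; apply: ler_sum => u uC; rewrite /hp /hn uC.
  by case: (leP (f u - m) 0) => h1; case: (leP (m - f u) 0) => h3; nra.
apply: le_trans (ler_wpM2l pd0 sumsq) _; rewrite mulrDr.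
apply: le_trans (lerD cp cn) _; rewrite -big_split /=.
apply: ler_sum => u uC; rewrite -big_split /=; apply: ler_sum => v vC.
(* [hp] increases and [hn] decreases with [f], so the cross term in the expansion of
   [(f u - f v) ^+ 2] is nonnegative. *)
rewrite -mulrDr ler_wpM2l // /hp /hn uC vC.
case: (leP (f u - m) 0) => h1; case: (leP (m - f u) 0) => h3;
case: (leP (f v - m) 0) => h4; case: (leP (m - f v) 0) => h5; nra.
Qed.

End Cheeger.

(** * Spectral contraction of lazy walks, and the walk reflected in a cluster *)

Section RegularMatrices.
Variables (R : realType) (n : nat).
Implicit Types (A B P Q K : 'M[R]_n) (d phi : R) (C : {set 'I_n}).

Lemma mulmx_expSr P t u v : (P ^+ t.+1) u v = \sum_w (P ^+ t) u w * P w v.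
Proof. by rewrite exprSr -mulmxE mxE. Qed.

Lemma sum_eq_op (u : 'I_n) : \sum_v (u == v)%:R = 1 :> R.
Proof.
rewrite (bigD1 u) //= eqxx big1 ?addr0 // => v /negbTE vu.
by rewrite eq_sym vu.
Qed.

(** Degree 1 makes [weighted_regular] mean symmetric and doubly stochastic, a property stable under
    products of commuting matrices. *)
Lemma weighted_regular_exp P t :
  weighted_regular P 1 -> weighted_regular (P ^+ t) 1.
Proof.
move=> [Psym P0 P1]; elim: t => [|t [IHsym IH0 IH1]]; split.
- by move=> u v; rewrite !mxE eq_sym.
- by move=> u v; rewrite mxE; case: eqP.
- by move=> u; under eq_bigr do rewrite mxE; rewrite sum_eq_op.
- move=> u v; rewrite mulmx_expSr exprS -mulmxE mxE.
  by apply: eq_bigr => w _; rewrite IHsym Psym mulrC.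
- by move=> u v; rewrite mulmx_expSr sumr_ge0 // => w _; rewrite mulr_ge0.
- move=> u; under eq_bigr do rewrite mulmx_expSr.
  rewrite exchange_big /= -[RHS](IH1 u); apply: eq_bigr => w _.
  by rewrite -mulr_sumr P1 mulr1.
Qed.

Lemma exp_mx_le K P t : (forall u v, 0 <= K u v <= P u v) ->
  forall u v, 0 <= (K ^+ t) u v <= (P ^+ t) u v.
Proof.
move=> KP; elim: t => [|t IH] u v.
  by rewrite mxE lexx andbT; case: eqP.
have [K0 IH0] : (forall u v, 0 <= K u v) /\ (forall u v, 0 <= (K ^+ t) u v).
  by split=> x y; [case/andP: (KP x y) | case/andP: (IH x y)].
rewrite !mulmx_expSr; apply/andP; split.
  by apply: sumr_ge0 => w _; rewrite mulr_ge0.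
by apply: ler_sum => w _; case/andP: (IH u w) => _ ?; case/andP: (KP w v) => _ ?;
  exact: ler_pM.
Qed.

Lemma transition_regular A d : 0 < d -> weighted_regular A d ->
  weighted_regular (transition A d) 1.
Proof.
move=> d0 [Asym A0 Ad]; split.
- by move=> u v; rewrite !mxE Asym eq_sym.
- move=> u v; rewrite !mxE mulr_ge0 ?invr_ge0 // addr_ge0 //.
  by rewrite mulr_ge0 // invr_ge0 ltW.
- move=> u; under eq_bigr do rewrite !mxE.
  rewrite -mulr_sumr big_split /= -mulr_sumr Ad.
  by rewrite sum_eq_op; field; rewrite gt_eqF.
Qed.

(** The case [e = 1] gives positive semidefiniteness of the lazy walk, and [e = -1] gives its
    Dirichlet form. *)
Lemma regular_sum_sq A d (e : R) (f : 'I_n -> R) : weighted_regular A d ->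
  \sum_u \sum_v A u v * (f u + e * f v) ^+ 2 =
  d * (1 + e ^+ 2) * \sum_u f u ^+ 2 + 2 * e * \sum_u \sum_v A u v * (f u * f v).
Proof.
move=> [Asym _ Ad].
have row : \sum_u \sum_v A u v * f u ^+ 2 = d * \sum_u f u ^+ 2.
  by rewrite mulr_sumr; apply: eq_bigr => u _; rewrite -mulr_suml Ad.
have col : \sum_u \sum_v A u v * f v ^+ 2 = d * \sum_u f u ^+ 2.
  rewrite exchange_big -row /=; apply: eq_bigr => u _; apply: eq_bigr => v _.
  by rewrite Asym.
have -> : d * (1 + e ^+ 2) * \sum_u f u ^+ 2 =
  d * \sum_u f u ^+ 2 + e ^+ 2 * (d * \sum_u f u ^+ 2) by ring.
rewrite -{1}row -col !mulr_sumr -!big_split /=; apply: eq_bigr => u _.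
rewrite !mulr_sumr -!big_split /=; apply: eq_bigr => v _; ring.
Qed.

Lemma transition_qform A d (f : 'I_n -> R) :
  \sum_u \sum_v transition A d u v * (f u * f v) =
  2^-1 * (\sum_u f u ^+ 2 + d^-1 * \sum_u \sum_v A u v * (f u * f v)).
Proof.
rewrite mulr_sumr -big_split mulr_sumr /=; apply: eq_bigr => u _.
have -> : f u ^+ 2 = \sum_v (u == v)%:R * (f u * f v).
  rewrite (bigD1 u) //= big1 => [|v /negbTE vu]; last by rewrite eq_sym vu mul0r.
  by rewrite eqxx mul1r addr0 expr2.
rewrite mulr_sumr -big_split mulr_sumr /=; apply: eq_bigr => v _.
by rewrite !mxE; ring.
Qed.

(* Laziness makes the transition matrix positive semidefinite. *)
Lemma transition_qform_ge0 A d (f : 'I_n -> R) :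
  0 < d -> weighted_regular A d ->
  0 <= \sum_u \sum_v transition A d u v * (f u * f v).
Proof.
move=> d0 Areg; have [_ A0 _] := Areg.
have := regular_sum_sq 1 f Areg.
set S := \sum_u \sum_v _; set F := \sum_u f u ^+ 2.
set G := \sum_u _ => SE.
have S0 : 0 <= S by do 2!(apply: sumr_ge0 => ? _); rewrite mulr_ge0 ?sqr_ge0.
rewrite transition_qform -/F -/G.
have -> : 2^-1 * (F + d^-1 * G) = (4 * d)^-1 * S.
  by rewrite SE; field; rewrite gt_eqF.
by rewrite mulr_ge0 // invr_ge0 mulr_ge0 // ltW.
Qed.

(** In [4 * d], one factor 2 comes from laziness and the other from counting each edge in both
    directions. *)
Lemma transition_qform_dirichlet A d (f : 'I_n -> R) :
  0 < d -> weighted_regular A d ->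
  \sum_u \sum_v transition A d u v * (f u * f v) =
  \sum_u f u ^+ 2 - (4 * d)^-1 * \sum_u \sum_v A u v * (f u - f v) ^+ 2.
Proof.
move=> d0 Areg.
have -> : \sum_u \sum_v A u v * (f u - f v) ^+ 2 =
    \sum_u \sum_v A u v * (f u + -1 * f v) ^+ 2.
  by apply: eq_bigr => u _; apply: eq_bigr => v _; rewrite mulN1r.
rewrite (regular_sum_sq _ _ Areg) transition_qform.
by field; rewrite gt_eqF.
Qed.

(* [|fQ|^2 = <f, Q (fQ)>] is bounded by Cauchy-Schwarz for the semidefinite
   form [Q], which yields the squared rate [rho ^+ 2] rather than [rho]. *)
Lemma psd_contraction Q (rho : R) (f : 'rV[R]_n) :
  (forall u v, Q u v = Q v u) ->
  (forall g : 'I_n -> R, 0 <= \sum_u \sum_v Q u v * (g u * g v)) ->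
  \sum_u \sum_v Q u v * (f 0 u * f 0 v) <= rho * \sum_u f 0 u ^+ 2 ->
  \sum_u \sum_v Q u v * ((f *m Q) 0 u * (f *m Q) 0 v)
    <= rho * \sum_u (f *m Q) 0 u ^+ 2 ->
  \sum_u (f *m Q) 0 u ^+ 2 <= rho ^+ 2 * \sum_u f 0 u ^+ 2.
Proof.
move=> Qsym Qpsd; set g := f *m Q.
set Bff := \sum_u \sum_v Q u v * (f 0 u * f 0 v).
set Bgg := \sum_u \sum_v Q u v * (g 0 u * g 0 v).
set F := \sum_u f 0 u ^+ 2; set G := \sum_u g 0 u ^+ 2 => hf hg.
pose Bfg := \sum_u \sum_v Q u v * (f 0 u * g 0 v).
have GE : G = Bfg.
  rewrite /Bfg exchange_big /=; apply: eq_bigr => v _.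
  rewrite expr2 {1}/g mxE mulr_suml; apply: eq_bigr => u _; ring.
have G0 : 0 <= G by apply: sumr_ge0 => u _; exact: sqr_ge0.
have F0 : 0 <= F by apply: sumr_ge0 => u _; exact: sqr_ge0.
have Bff0 : 0 <= Bff by exact: (Qpsd (fun u => f 0 u)).
have Bgg0 : 0 <= Bgg by exact: (Qpsd (fun u => g 0 u)).
have CS : Bfg ^+ 2 <= Bff * Bgg.
  apply: discriminant_le0 => // s.
  have -> : Bff + 2 * s * Bfg + s ^+ 2 * Bgg =
      \sum_u \sum_v Q u v * ((f 0 u + s * g 0 u) * (f 0 v + s * g 0 v)).
    have -> : 2 * s * Bfg = s * Bfg + s * \sum_u \sum_v Q u v * (g 0 u * f 0 v).
      have -> : \sum_u \sum_v Q u v * (g 0 u * f 0 v) = Bfg.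
        rewrite exchange_big; apply: eq_bigr => u _; apply: eq_bigr => v _.
        by rewrite Qsym [g 0 v * _]mulrC.
      by ring.
    rewrite !mulr_sumr -!big_split /=; apply: eq_bigr => u _.
    by rewrite !mulr_sumr -!big_split /=; apply: eq_bigr => v _; ring.
  exact: Qpsd.
have [G00|Gn0] := eqVneq G 0; first by rewrite G00 mulr_ge0 ?sqr_ge0.
have Gp : 0 < G by rewrite lt_def Gn0.
(* Multiplied by [G], the goal bounds [G ^+ 2 = Bfg ^+ 2]; each factor of [Bff * Bgg] then
   contributes one [rho]. *)
rewrite -(ler_pM2r Gp) -expr2 {1}GE (le_trans CS) //.
have -> : rho ^+ 2 * F * G = (rho * F) * (rho * G) by ring.
exact: ler_pM.
Qed.

(** Applied to [A] it keeps the edges inside [C]; applied to a transition matrix it is the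
    substochastic kernel of the walk killed on leaving [C]. *)
Definition restrict C A : 'M[R]_n :=
  \matrix_(u, v) (if (u \in C) && (v \in C) then A u v else 0).

(* Edges leaving [C] become self-loops; vertices outside [C] only keep a loop
   of weight [d], so that the matrix remains [d]-regular. *)
Definition reflect_in C A d : 'M[R]_n :=
  restrict C A + diag_mx (\row_u (d - \sum_v restrict C A u v)).

Lemma restrict_bounds C A : (forall u v, 0 <= A u v) ->
  forall u v, 0 <= restrict C A u v <= A u v.
Proof. by move=> A0 u v; rewrite mxE; case: ifP; rewrite ?lexx A0. Qed.

Lemma reflect_inE C A d u v : reflect_in C A d u v =
  restrict C A u v + (u == v)%:R * (d - \sum_w restrict C A u w).
Proof. by rewrite !mxE -mulrb; case: eqP; rewrite ?mul1r ?mul0r. Qed.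

Lemma restrict_row_le C A d u : weighted_regular A d ->
  \sum_v restrict C A u v <= d.
Proof.
move=> [_ A0 Ad]; rewrite -(Ad u); apply: ler_sum => v _.
by case/andP: (restrict_bounds C A0 u v).
Qed.

Lemma reflect_in_regular C A d :
  weighted_regular A d -> weighted_regular (reflect_in C A d) d.
Proof.
move=> Areg; have [Asym A0 Ad] := Areg; split.
- move=> u v; rewrite !reflect_inE [v == u]eq_sym.
  case: eqP => [->//|_]; rewrite !mul0r !addr0 !mxE andbC.
  by case: ifP => // _; rewrite Asym.
- move=> u v; rewrite reflect_inE addr_ge0 //.
    by case/andP: (restrict_bounds C A0 u v).
  by rewrite mulr_ge0 // ?subr_ge0 ?restrict_row_le //; case: eqP.
- move=> u; under eq_bigr do rewrite reflect_inE.
  by rewrite big_split /= -mulr_suml sum_eq_op mul1r addrC subrK.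
Qed.

(** Loops contribute [f u - f u = 0], so only the edges inside [C] remain and Cheeger's inequality
    applies. *)
Lemma reflect_in_dirichlet C A d (f : 'I_n -> R) :
  \sum_u \sum_v reflect_in C A d u v * (f u - f v) ^+ 2 =
  \sum_(u in C) \sum_(v in C) A u v * (f u - f v) ^+ 2.
Proof.
rewrite [RHS]big_mkcond /=; apply: eq_bigr => u _.
have -> : (if u \in C then \sum_(v in C) A u v * (f u - f v) ^+ 2 else 0) =
    \sum_v restrict C A u v * (f u - f v) ^+ 2.
  case: ifP => uC.
    rewrite big_mkcond /=; apply: eq_bigr => v _; rewrite mxE uC /=.
    by case: ifP => // _; rewrite mul0r.
  by rewrite big1 // => v _; rewrite mxE uC mul0r.
apply: eq_bigr => v _; rewrite reflect_inE.
by case: eqP => [->|_]; rewrite ?subrr ?expr0n ?mulr0 // mul0r addr0.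
Qed.

Lemma reflect_in_transition0 C A d u v : (u \in C) != (v \in C) ->
  transition (reflect_in C A d) d u v = 0.
Proof.
move=> uv; have /negbTE nuv : u != v by apply: contraNneq uv => ->.
rewrite mxE [X in _ * X]mxE [X in _ + X]mxE reflect_inE !mxE nuv mul0r addr0.
suff -> : (u \in C) && (v \in C) = false by rewrite mulr0 addr0 mulr0.
by move: uv; case: (u \in C); case: (v \in C).
Qed.

(** Inside [C], reflection only adds loop mass to the original transitions. The killed walk thus
    lies below the reflected walk as well as the original one. *)
Lemma restrict_transition_le C A d : 0 < d -> weighted_regular A d ->
  forall u v, 0 <= restrict C (transition A d) u v <=
              transition (reflect_in C A d) d u v.
Proof.
move=> d0 Areg u v.
have Breg := reflect_in_regular C Areg.
have [_ P0 _] := transition_regular d0 Areg.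
have [_ Q0 _] := transition_regular d0 Breg.
have /andP[-> _] := restrict_bounds C P0 u v; rewrite [leLHS]mxE /=.
case: ifP => uvC; last exact: Q0.
rewrite mxE [leRHS]mxE ler_wpM2l ?invr_ge0 // [leLHS]mxE [leRHS]mxE lerD2l.
rewrite [leLHS]mxE [leRHS]mxE ler_wpM2l ?invr_ge0 ?(ltW d0) //.
rewrite reflect_inE mxE uvC lerDl mulr_ge0 ?subr_ge0 ?restrict_row_le //.
Qed.

(** An invariant subspace avoiding the evident fixed vectors of the reflected walk: the sum
    condition excludes the uniform distribution on [C], the support condition the vertices outside
    [C], where that walk stands still. *)
Definition centered_on C (f : 'rV[R]_n) : Prop :=
  (forall u, u \notin C -> f 0 u = 0) /\ \sum_u f 0 u = 0.

Lemma reflect_in_centered C A d f : 0 < d -> weighted_regular A d ->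
  centered_on C f -> centered_on C (f *m transition (reflect_in C A d) d).
Proof.
move=> d0 Areg [fC f0].
have [_ _ Q1] := transition_regular d0 (reflect_in_regular C Areg).
split=> [v vC|].
  rewrite mxE big1 // => u _; have [uC|uC] := boolP (u \in C).
    by rewrite reflect_in_transition0 ?mulr0 // uC (negbTE vC).
  by rewrite fC ?mul0r.
under eq_bigr do rewrite mxE.
rewrite exchange_big -[RHS]f0 /=; apply: eq_bigr => u _.
by rewrite -mulr_sumr Q1 mulr1.
Qed.

Lemma reflect_in_contraction C A d phi f : 0 < d -> weighted_regular A d ->
  0 <= phi -> phi <= inner_conductance A d C -> centered_on C f ->
  \sum_u (f *m transition (reflect_in C A d) d) 0 u ^+ 2 <=
  (1 - phi ^+ 2 / 4) ^+ 2 * \sum_u f 0 u ^+ 2.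
Proof.
move=> d0 Areg phi0 hphi fC.
have Breg := reflect_in_regular C Areg.
have [Qsym _ _] := transition_regular d0 Breg.
have gap (g : 'rV[R]_n) : centered_on C g ->
    \sum_u \sum_v transition (reflect_in C A d) d u v * (g 0 u * g 0 v)
    <= (1 - phi ^+ 2 / 4) * \sum_u g 0 u ^+ 2.
  move=> [gC g0].
  have onC (p : R -> R) : p 0 = 0 -> \sum_u p (g 0 u) = \sum_(u in C) p (g 0 u).
    move=> p0; rewrite [RHS]big_mkcond; apply: eq_bigr => u _.
    by case: ifPn => // /gC ->.
  have := @cheeger_ineq R n A d phi C (fun u => g 0 u) d0 Areg phi0 hphi.
  rewrite -(onC id) // -(onC (fun x => x ^+ 2)) ?expr0n //= => /(_ g0).
  rewrite transition_qform_dirichlet // reflect_in_dirichlet.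
  set G := \sum_u _; set E := \sum_(u in C) _ => GE.
  (* The gap is the Cheeger constant [phi ^+ 2 * d] divided by the normalisation [4 * d] of the
     Dirichlet form. *)
  have -> : (1 - phi ^+ 2 / 4) * G = G - (4 * d)^-1 * (phi ^+ 2 * d * G).
    by field; rewrite gt_eqF.
  by rewrite lerD2l lerN2 ler_wpM2l // invr_ge0 mulr_ge0 // ltW.
apply: psd_contraction => //.
- by move=> g; exact: transition_qform_ge0.
- exact: gap.
- by apply: gap; exact: reflect_in_centered.
Qed.

Lemma reflect_in_decay C A d phi f t : 0 < d -> weighted_regular A d ->
  0 <= phi -> phi <= inner_conductance A d C -> centered_on C f ->
  \sum_u (f *m transition (reflect_in C A d) d ^+ t) 0 u ^+ 2 <=
  (1 - phi ^+ 2 / 4) ^+ (2 * t) * \sum_u f 0 u ^+ 2.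
Proof.
move=> d0 Areg phi0 hphi; elim: t f => [|t IH] f fC.
  by rewrite muln0 !expr0 -idmxE mulmx1 mul1r.
rewrite exprS -mulmxE mulmxA mulnS exprD.
apply: le_trans (IH _ (reflect_in_centered d0 Areg fC)) _.
rewrite -mulrA [leRHS]mulrCA ler_wpM2l ?reflect_in_contraction //.
by rewrite exprM exprn_ge0 // sqr_ge0.
Qed.

Lemma uniform_on_stationary C A d t : 0 < d -> weighted_regular A d ->
  uniform_on R C *m transition (reflect_in C A d) d ^+ t = uniform_on R C.
Proof.
move=> d0 Areg.
have [Qsym _ Q1] := transition_regular d0 (reflect_in_regular C Areg).
elim: t => [|t IH]; first by rewrite expr0 -idmxE mulmx1.
rewrite exprSr -mulmxE mulmxA IH; apply/rowP => w; rewrite mxE.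
(* Nonzero transitions join vertices on the same side of [C], where the uniform density takes equal
   values; it can be read off at [w] and factored out of a row sum. *)
rewrite (eq_bigr (fun u => uniform_on R C 0 w *
    transition (reflect_in C A d) d w u)) => [|u _].
  by rewrite -mulr_sumr Q1 mulr1.
have [uw|uw] := eqVneq (u \in C) (w \in C); last first.
  by rewrite Qsym reflect_in_transition0 ?mulr0 // eq_sym.
by rewrite Qsym; congr (_ * _); rewrite !mxE uw.
Qed.

End RegularMatrices.

(** * The killed walk and the probability of escaping from a cluster *)

Section Escape.
Variables (R : realType) (n : nat) (P : 'M[R]_n) (C : {set 'I_n}).
Hypothesis Preg : weighted_regular P 1.

Let K := restrict C P.
(** The probability that the walk started at [v] in [C] remains in [C] throughout its first [t]
    steps. *)
Let stay t v := \sum_(w in C) (K ^+ t) v w.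

Lemma killed_exp_bounds t u v : 0 <= (K ^+ t) u v <= (P ^+ t) u v.
Proof. by apply: exp_mx_le => ? ?; apply: restrict_bounds; case: Preg. Qed.

Lemma stay_stepE t v :
  stay t v - stay t.+1 v =
  \sum_(u in C) (K ^+ t) v u * \sum_(w in ~: C) P u w.
Proof.
have [_ _ P1] := Preg.
have -> : stay t.+1 v = \sum_(u in C) (K ^+ t) v u * \sum_(w in C) P u w.
  rewrite /stay; under eq_bigr do rewrite mulmx_expSr.
  rewrite exchange_big [RHS]big_mkcond /=; apply: eq_bigr => u _.
  case: ifP => uC; last by rewrite big1 // => w _; rewrite mxE uC mulr0.
  by rewrite -mulr_sumr; congr (_ * _); apply: eq_bigr => w wC; rewrite mxE uC wC.
rewrite -sumrB; apply: eq_bigr => u uC.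
rewrite -{1}[_ v u]mulr1 -mulrBr -(P1 u) (bigID (mem C)) /=; congr (_ * _).
by rewrite addrAC subrr add0r; apply: eq_bigl => w; rewrite inE.
Qed.

(** This lets a set of good starting points chosen for one time horizon serve for all earlier
    times. *)
Lemma stay_nonincreasing s t v : (s <= t)%N -> stay t v <= stay s v.
Proof.
have [_ P0 _] := Preg.
apply: (@homo_leq _ (fun t => stay t v) (fun x y => y <= x)) => [x|x y z|{}t] //.
  by move=> zx yz; exact: le_trans yz zx.
rewrite -subr_ge0 stay_stepE sumr_ge0 // => u _.
rewrite mulr_ge0 ?sumr_ge0 //.
by case/andP: (killed_exp_bounds t v u).
Qed.

Lemma sum_escape_le t :
  \sum_(v in C) (1 - stay t v) <= t%:R * weight P C (~: C).
Proof.
have [_ P0 _] := Preg.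
elim: t => [|t IH].
  rewrite mul0r big1 // => v vC; rewrite /stay (bigD1 v) //= big1 => [|w].
    by rewrite mxE eqxx addr0 subrr.
  by case/andP => _ /negbTE wv; rewrite mxE eq_sym wv.
have -> : \sum_(v in C) (1 - stay t.+1 v) =
    \sum_(v in C) (1 - stay t v) + \sum_(v in C) (stay t v - stay t.+1 v).
  by rewrite -big_split /=; apply: eq_bigr => v _; ring.
rewrite -natr1 mulrDl mul1r lerD //.
under eq_bigr do rewrite stay_stepE.
rewrite exchange_big /=; apply: ler_sum => u uC.
rewrite -mulr_suml -[leRHS]mul1r ler_wpM2r ?sumr_ge0 //.
(* The killed mass reaching [u] from all starts in [C] is a partial column sum of [K ^+ t]; by
   symmetry it is at most a row sum of [P ^+ t], that is 1. Each step therefore leaks at most the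
   weight of the cut. *)
have [Tsym T0 T1] := weighted_regular_exp t Preg.
rewrite -(T1 u) [leRHS](bigID (mem C)) /= -[leLHS]addr0 lerD ?sumr_ge0 //.
apply: ler_sum => v _; rewrite Tsym.
by case/andP: (killed_exp_bounds t v u).
Qed.

(** If [k] is at most both [p] and [q], then [|p - q| <= p + q - 2 k]. Taking [k] from the killed
    walk and summing gives at most [2 - 2 * stay t v], which is then halved. *)
Lemma tv_dist_le_escape (Q : 'M[R]_n) t v : weighted_regular Q 1 ->
  (forall u w, 0 <= K u w <= Q u w) ->
  tv_dist (delta_mx 0 v *m P ^+ t) (delta_mx 0 v *m Q ^+ t) <= 1 - stay t v.
Proof.
move=> Qreg KQ.
have [_ _ P1] := weighted_regular_exp t Preg.
have [_ _ Q1] := weighted_regular_exp t Qreg.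
have -> : 1 - stay t v = 2^-1 * (\sum_w (P ^+ t) v w + \sum_w (Q ^+ t) v w
    - 2 * stay t v) by rewrite P1 Q1; field.
rewrite /tv_dist ler_wpM2l ?invr_ge0 //.
apply: (@le_trans _ _ (\sum_w (P ^+ t) v w + \sum_w (Q ^+ t) v w
    - 2 * \sum_w (K ^+ t) v w)); last first.
  rewrite lerD2l lerN2 ler_wpM2l // [leRHS](bigID (mem C)) /= lerDl sumr_ge0 //.
  by move=> w _; case/andP: (killed_exp_bounds t v w).
rewrite mulr_sumr -big_split -sumrB /=; apply: ler_sum => w _.
rewrite -!rowE !mxE.
have /andP[_ KP'] := killed_exp_bounds t v w.
have /andP[_ KQ'] := exp_mx_le t KQ v w.
by rewrite ler_norml; apply/andP; split; move: KP' KQ'; lra.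
Qed.

(* Markov's inequality for the escape probability of a uniform start in [C]. *)
Lemma card_few_escape t (e b : R) : 0 < e ->
  t%:R * weight P C (~: C) <= e * (b * #|C|%:R) ->
  (1 - b) * #|C|%:R <= #|[set v in C | 1 - stay t v <= e]|%:R.
Proof.
move=> e0 hw; set G := [set v in C | _].
have stay1 v : 0 <= 1 - stay t v.
  have [_ T0 T1] := weighted_regular_exp t Preg.
  rewrite subr_ge0 -(T1 v) [leRHS](bigID (mem C)) /= -[leLHS]addr0.
  rewrite lerD ?sumr_ge0 //; apply: ler_sum => w _.
  by case/andP: (killed_exp_bounds t v w).
have GC : G \subset C by apply/subsetP => v; rewrite inE => /andP[].
have cC : #|C|%:R = #|G|%:R + #|C :\: G|%:R :> R.
  by rewrite -natrD -[in LHS](cardsID G C) (setIidPr GC).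
have : e * #|C :\: G|%:R <= e * (b * #|C|%:R).
  apply: le_trans hw; apply: le_trans (sum_escape_le t).
  rewrite (big_setID G) /= -[leLHS]add0r lerD ?sumr_ge0 //.
  rewrite mulr_natr -sumr_const; apply: ler_sum => v.
  by rewrite !inE negb_and => /andP[/orP[/negbTE->//|]]; rewrite -ltNge => /ltW.
rewrite ler_pM2l //; move: cC; lra.
Qed.

End Escape.

(** * Total variation bounds for the reflected and the original walk *)

Section Mixing.
Variables (R : realType) (n : nat).
Implicit Types (A : 'M[R]_n) (d phi : R) (C : {set 'I_n}).

Lemma tv_dist_triangle (p q r : 'rV[R]_n) :
  tv_dist p r <= tv_dist p q + tv_dist q r.
Proof.
rewrite /tv_dist -mulrDr ler_wpM2l ?invr_ge0 // -big_split /=.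
by apply: ler_sum => i _; exact: ler_distD.
Qed.

Lemma tv_dist_ge0 (p q : 'rV[R]_n) : 0 <= tv_dist p q.
Proof. by rewrite mulr_ge0 ?invr_ge0 ?sumr_ge0. Qed.

Lemma tv_dist_sqr_le (p q : 'rV[R]_n) :
  tv_dist p q ^+ 2 <= 4^-1 * (n%:R * \sum_u (p - q) 0 u ^+ 2).
Proof.
have := @cauchy_schwarz_sum R 'I_n predT (fun=> 1) (fun=> 1)
  (fun u => `|p 0 u - q 0 u|) (fun _ _ => ler01).
under eq_bigr do rewrite !mul1r.
rewrite [X in _ <= X * _](eq_bigr (fun=> 1)) => [|u _]; last first.
  by rewrite expr1n mulr1.
rewrite sumr_const card_ord => CS.
rewrite /tv_dist exprMn; have -> : 2^-1 ^+ 2 = 4^-1 :> R by field.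
rewrite ler_wpM2l ?invr_ge0 // (le_trans CS) // ler_wpM2l //.
apply: ler_sum => u _; rewrite mul1r !mxE.
by rewrite real_normK ?num_real.
Qed.

Lemma sum_uniform_on C : C != set0 -> \sum_u uniform_on R C 0 u = 1.
Proof.
move=> C0; under eq_bigr do rewrite mxE.
rewrite -big_mkcond /= sumr_const -[LHS]mulr_natr mulVf //.
by rewrite pnatr_eq0 cards_eq0.
Qed.

Lemma sum_delta_row (g : 'I_n -> R) v :
  \sum_u (delta_mx 0 v : 'rV[R]_n) 0 u * g u = g v.
Proof.
rewrite (bigD1 v) //= big1 => [|u /negbTE uv]; rewrite mxE ?uv ?mul0r //.
by rewrite !eqxx mul1r addr0.
Qed.

Lemma delta_uniform_centered C v : v \in C ->
  centered_on C (delta_mx 0 v - uniform_on R C).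
Proof.
move=> vC; split=> [u uC|].
  rewrite !mxE (negbTE uC) subr0 eqxx /=; case: eqP => // uv.
  by rewrite uv vC in uC.
under eq_bigr do rewrite mxE [X in _ + X]mxE.
rewrite sumrB sum_uniform_on; last by apply/set0Pn; exists v.
rewrite (eq_bigr (fun u => (delta_mx 0 v : 'rV[R]_n) 0 u * 1)) => [|u _].
  by rewrite sum_delta_row subrr.
by rewrite mulr1.
Qed.

(** The difference [f] is supported in [C] and sums to zero, so its squared norm is its pairing with
    the point mass at [v], namely [1 - #|C|^-1]. *)
Lemma delta_uniform_sqr_le1 C v : v \in C ->
  \sum_u (delta_mx 0 v - uniform_on R C) 0 u ^+ 2 <= 1.
Proof.
move=> vC; have [fC f0] := delta_uniform_centered vC.
set f := delta_mx 0 v - uniform_on R C in fC f0 *.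
have -> : \sum_u f 0 u ^+ 2 = \sum_u (delta_mx 0 v : 'rV[R]_n) 0 u * f 0 u
    - #|C|%:R^-1 * \sum_u f 0 u.
  rewrite mulr_sumr -sumrB; apply: eq_bigr => u _; rewrite -mulrBl expr2.
  have [uC|uC] := boolP (u \in C); last by rewrite fC ?mulr0.
  by congr (_ * _); rewrite !mxE uC.
rewrite f0 mulr0 subr0 sum_delta_row !mxE vC !eqxx.
by rewrite gerBl invr_ge0.
Qed.

Lemma reflect_in_mixing C A d phi v t : 0 < d -> weighted_regular A d ->
  0 <= phi -> phi <= inner_conductance A d C -> v \in C ->
  tv_dist (delta_mx 0 v *m transition (reflect_in C A d) d ^+ t)
    (uniform_on R C) ^+ 2 <=
  4^-1 * (n%:R * (1 - phi ^+ 2 / 4) ^+ (2 * t)).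
Proof.
move=> d0 Areg phi0 hphi vC.
apply: le_trans (tv_dist_sqr_le _ _) _.
rewrite ler_wpM2l ?invr_ge0 // ler_wpM2l //.
(* Stationarity turns the error after [t] steps into the image of the centered initial error. *)
rewrite -[X in _ - X](uniform_on_stationary C t d0 Areg) -mulmxBl.
apply: le_trans (reflect_in_decay t d0 Areg phi0 hphi
  (delta_uniform_centered vC)) _.
rewrite -[leRHS]mulr1 ler_wpM2l ?delta_uniform_sqr_le1 //.
by rewrite exprM exprn_ge0 // sqr_ge0.
Qed.

(** The identity part of the lazy walk never crosses the cut, and laziness halves the rest. *)
Lemma weight_transition A d C : 0 < d ->
  weight (transition A d) C (~: C) = 2^-1 * (conductance A d C * #|C|%:R).
Proof.
move=> d0; have [->|Cn0] := eqVneq C set0.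
  by rewrite cards0 mulr0 mulr0 /weight big_set0.
have cn0 : #|C|%:R != 0 :> R by rewrite pnatr_eq0 cards_eq0.
have -> : conductance A d C * #|C|%:R = d^-1 * weight A C (~: C).
  by rewrite /conductance; field; rewrite cn0 gt_eqF.
rewrite /weight !mulr_sumr; apply: eq_bigr => u uC.
rewrite !mulr_sumr; apply: eq_bigr => v; rewrite inE => vC.
rewrite !mxE; case: eqP => [uv|_]; last by rewrite add0r.
by rewrite -uv uC in vC.
Qed.

(** One [e] pays for escape, the other for mixing of the reflected walk. The set [C'] depends on the
    horizon [T] only, so it is the same for all [t <= T]. The factors 2 come from the halved leak
    and from the one half in [tv_dist]. *)
Lemma walk_dist_mixing C A d phi (e b : R) T : 0 < d -> weighted_regular A d ->
  0 <= phi -> phi <= inner_conductance A d C -> 0 < e ->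
  T%:R * conductance A d C <= 2 * e * b ->
  exists C' : {set 'I_n},
    [/\ C' \subset C, (1 - b) * #|C|%:R <= #|C'|%:R
      & forall v t, v \in C' -> (t <= T)%N ->
          n%:R * (1 - phi ^+ 2 / 4) ^+ (2 * t) <= (2 * e) ^+ 2 ->
          tv_dist (walk_dist A d v t) (uniform_on R C) <= e + e].
Proof.
move=> d0 Areg phi0 hphi e0 hT.
have Preg := transition_regular d0 Areg.
have hw : T%:R * weight (transition A d) C (~: C) <= e * (b * #|C|%:R).
  rewrite weight_transition //.
  by have := ler_wpM2r (ler0n R #|C|) hT; lra.
have := card_few_escape Preg e0 hw; set C' := [set v in C | _] => cardC'.
exists C'; split=> // [|v t vC' tT decay].
  by apply/subsetP => v; rewrite inE => /andP[].
move: vC'; rewrite inE => /andP[vC stayv].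
apply: le_trans (tv_dist_triangle _
  (delta_mx 0 v *m transition (reflect_in C A d) d ^+ t) _) _.
apply: lerD.
  have Qreg := transition_regular d0 (reflect_in_regular C Areg).
  have := tv_dist_le_escape Preg t v Qreg (restrict_transition_le C d0 Areg).
  move=> /le_trans; apply; apply: le_trans stayv.
  by rewrite lerD2l lerN2 stay_nonincreasing.
rewrite -(@ler_pXn2r _ 2) ?nnegrE ?tv_dist_ge0 ?(ltW e0) //.
apply: le_trans (reflect_in_mixing t d0 Areg phi0 hphi vC) _.
by move: decay; lra.
Qed.

Lemma inner_conductance_le1 A d C : inner_conductance A d C <= 1.
Proof. exact: bigmin_le_id. Qed.

Lemma conductance_ge0 A d C : 0 < d -> weighted_regular A d ->
  0 <= conductance A d C.
Proof.
move=> d0 [_ A0 _]; rewrite divr_ge0 ?mulr_ge0 ?(ltW d0) //.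
by apply: sumr_ge0 => u _; exact: sumr_ge0.
Qed.

End Mixing.

(** * Estimates for the walk length and the constants *)

Section Numerics.
Variable R : realType.

(** From [exp (- 1/2) >= 1 - 1/2] follows [exp (1/2) <= 2 <= n]. This crude bound absorbs the
    rounding of the walk length. *)
Lemma ln_nat_ge_half (n : nat) : (1 < n)%N -> 2^-1 <= ln (n%:R : R).
Proof.
move=> n1; have n0 : 0 < n%:R :> R by rewrite ltr0n ltnW.
rewrite -ler_expR lnK ?posrE //; apply: (@le_trans _ _ 2); last by rewrite ler_nat.
have := expR_ge1Dx (- 2^-1 : R); rewrite expRN => h.
have h2 : 2^-1 <= (expR 2^-1)^-1 :> R by move: h; lra.
by move: h2; rewrite lef_pV2 ?posrE ?expR_gt0.
Qed.

(* [(1 - phi^2/4)^(2t) <= exp (- t phi^2 / 2) <= exp (1/2) * n^-10]. *)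
Lemma mixing_time_decay (n t : nat) (phi : R) : (1 < n)%N -> 0 < phi <= 1 ->
  20 * ln n%:R / phi ^+ 2 - 1 < t%:R ->
  n%:R * (1 - phi ^+ 2 / 4) ^+ (2 * t) <= (n%:R ^- 4) ^+ 2.
Proof.
move=> n1 /andP[phi0 phi1] ht.
have n0 : 0 < n%:R :> R by rewrite ltr0n ltnW.
have p2 : 0 < phi ^+ 2 by rewrite exprn_gt0.
have p21 : phi ^+ 2 <= 1 by rewrite exprn_ile1 // ltW.
have L := ln_nat_ge_half n1; set l := ln n%:R in ht L *.
have {}ht : 20 * l - phi ^+ 2 <= t%:R * phi ^+ 2.
  have -> : 20 * l - phi ^+ 2 = (20 * l / phi ^+ 2 - 1) * phi ^+ 2.
    by field; rewrite gt_eqF.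
  by rewrite ler_wpM2r // ltW.
have base : (1 - phi ^+ 2 / 4) ^+ (2 * t) <= expR (- (t%:R * phi ^+ 2 / 2)).
  have -> : - (t%:R * phi ^+ 2 / 2) = (2 * t)%:R * (- (phi ^+ 2 / 4)).
    by rewrite natrM; field.
  rewrite expRM_natl lerXn2r ?nnegrE ?expR_ge0 //; first lra.
  exact: expR_ge1Dx.
have nE : n%:R = expR l by rewrite lnK.
apply: le_trans (ler_wpM2l (ltW n0) base) _.
rewrite -exprVn nE -expRN -exprM -expRM_natl -expRD ler_expR.
(* The exponent is at most [l - (10 * l - 1/2)], which is at most [- 8 * l] exactly when
   [l >= 1/2]. *)
by rewrite (_ : (4 * 2)%N%:R = 8) //; lra.
Qed.

(** Since [20 * l / phi ^+ 2 >= 1], the rounding [+ 1] is absorbed by doubling 20 to 40, and the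
    constant [40^-1] cancels that 40. *)
Lemma few_steps_leak (k : nat) (alpha beta xi phi l T c : R) :
  (0 < k)%N -> 0 < phi <= 1 -> 2^-1 <= l -> 0 <= alpha <= 1 -> 0 <= beta ->
  0 <= xi -> T <= 20 * l / phi ^+ 2 + 1 -> 0 <= c ->
  c <= 40^-1 * (xi * alpha * beta * phi ^+ 2 / (k%:R ^+ 3 * l)) ->
  T * c <= xi * beta.
Proof.
move=> k0 /andP[phi0 phi1] l2 /andP[a0 a1] b0 x0 hT c0 hc.
have p2 : 0 < phi ^+ 2 by rewrite exprn_gt0.
have p21 : phi ^+ 2 <= 1 by rewrite exprn_ile1 // ltW.
have l0 : 0 < l by lra.
have k1 : 1 <= k%:R ^+ 3 :> R by rewrite exprn_ege1 // ler1n.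
have hT' : T <= 40 * l / phi ^+ 2.
  apply: le_trans hT _.
  have : 1 <= 20 * l / phi ^+ 2 by rewrite ler_pdivlMr //; lra.
  by lra.
have hc' : c <= 40^-1 * (xi * beta * phi ^+ 2 / l).
  apply: le_trans hc _; rewrite ler_wpM2l ?invr_ge0 // invfM mulrA.
  rewrite ler_wpM2r ?invr_ge0 ?(ltW l0) // ler_pdivrMr ?(lt_le_trans ltr01) //.
  have X0 : 0 <= xi * beta * phi ^+ 2 by rewrite !mulr_ge0 // ltW.
  apply: (@le_trans _ _ (xi * beta * phi ^+ 2)).
    have -> : xi * alpha * beta * phi ^+ 2 = alpha * (xi * beta * phi ^+ 2) by ring.
    by rewrite ler_piMl.
  by rewrite ler_peMr.
apply: le_trans (ler_wpM2r c0 hT') _.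
have lp : 0 <= 40 * l / phi ^+ 2 by rewrite divr_ge0 ?mulr_ge0 // ltW.
apply: le_trans (ler_wpM2l lp hc') _.
rewrite le_eqVlt; apply/orP; left; apply/eqP; field.
by rewrite !gt_eqF.
Qed.

End Numerics.

(** * Choice of the absolute constant and rounding of the walk length *)

Theorem theorem4 (R : realType) :
  exists2 a : R, 0 < a &
  forall (alpha beta xi phi_in phi_out d : R) (n k : nat)
         (A : 'M[R]_n) (Cs : {set {set 'I_n}}),
    0 < alpha <= 1 -> 0 < beta <= 1 -> 0 < xi <= 1 ->
    n%:R ^- 4 <= xi ->
    0 < phi_in -> 0 < d ->
    phi_out <= a * (xi * alpha * beta * phi_in ^+ 2 / (k%:R ^+ 3 * ln n%:R)) ->
    weighted_regular A d ->
    clusterable A d k phi_in phi_out Cs ->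
    forall C : {set 'I_n}, C \in Cs -> alpha * n%:R <= #|C|%:R ->
    exists C' : {set 'I_n},
      [/\ C' \subset C,
          (1 - beta) * #|C|%:R <= #|C'|%:R
        & forall (v : 'I_n) (t : nat), v \in C' ->
            `|t%:R - 20 * ln n%:R / phi_in ^+ 2| < 1 ->
            tv_dist (walk_dist A d v t) (uniform_on R C) <= xi].
Proof.
exists 40^-1; first by rewrite invr_gt0.
move=> alpha beta xi phi phi_out d n k A Cs /andP[a0 a1] /andP[b0 b1].
move=> /andP[x0 x1] hn phi0 d0 hout Areg [part hk hC] C CCs _.
have [hin hcond] := hC _ CCs.
have phi1 : phi <= 1 := le_trans hin (inner_conductance_le1 _ _ _).
have k0 : (0 < k)%N by rewrite (leq_trans _ hk) // card_gt0; apply/set0Pn; exists C.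
(* For a single vertex [ln n] vanishes, which forces [t = 0], and the point mass is already uniform
   on its cluster. *)
have [n1|n1] := leqP n 1.
  exists C; split=> //; first by rewrite ler_piMl // gerBl ltW.
  move=> v t vC; have lnn : ln (n%:R : R) = 0.
    have -> : n = 1%N by apply/eqP; rewrite eqn_leq n1 (leq_ltn_trans _ (ltn_ord v)).
    exact: ln1.
  rewrite lnn mulr0 mul0r subr0 ger0_norm // ltrn1 ltnS leqn0 => /eqP ->.
  have C1 : C = [set v].
    apply/setP => u; rewrite inE; have -> : u = v.
      have ord0 (w : 'I_n) : w = 0%N :> nat.
        by apply/eqP; rewrite -leqn0 -ltnS (leq_trans (ltn_ord w) n1).
      by apply/val_inj; rewrite /= !ord0.
    by rewrite eqxx vC.
  apply: le_trans (ltW x0).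
  rewrite /tv_dist /walk_dist expr0 -idmxE mulmx1 big1 ?mulr0 // => u _.
  by rewrite !mxE C1 cards1 invr1 inE eqxx /=; case: eqP; rewrite subrr normr0.
pose x := 20 * ln n%:R / phi ^+ 2.
(* Any natural [t] with [t < x + 1] is at most this [T], while [T <= x + 1] keeps the leak under
   control. *)
pose T := (Num.truncn x).+1.
have L := ln_nat_ge_half R n1.
have xge0 : 0 <= x by rewrite divr_ge0 ?sqr_ge0 // mulr_ge0 //; lra.
have /andP[Tx xT] := truncn_itv xge0.
have hT : T%:R * conductance A d C <= 2 * (xi / 2) * beta.
  have -> : 2 * (xi / 2) = xi by field.
  apply: (@few_steps_leak R k alpha beta xi phi (ln n%:R)) => //.
  - by rewrite phi0.
  - by rewrite ltW.
  - exact: ltW.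
  - exact: ltW.
  - by rewrite -[leLHS]natr1 lerD2r.
  - exact: conductance_ge0.
  - exact: le_trans hcond hout.
have xi2 : 0 < xi / 2 by rewrite divr_gt0.
have [C' [C'C cardC' mixC']] := walk_dist_mixing d0 Areg (ltW phi0) hin xi2 hT.
exists C'; split=> // v t vC'; rewrite ltr_distl => /andP[tlo thi].
have -> : xi = xi / 2 + xi / 2 by field.
apply: mixC' => //.
  rewrite -ltnS -(ltr_nat R) (lt_le_trans thi) // -[leRHS]natr1 lerD2r.
  exact: ltW.
(* The spectral error is compared with [n ^- 4], and [hn] bounds that by [xi]. *)
apply: le_trans (mixing_time_decay n1 _ tlo) _; first by rewrite phi0.
have -> : 2 * (xi / 2) = xi by field.
by rewrite lerXn2r ?nnegrE ?(ltW x0) // invr_ge0 exprn_ge0.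
Qed.
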